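(* Let $$g_1(\mathbf{x})\;:\;\forall(\mathbf{x}_1,\{\mathbf{x}_{w2}\})\bigl(d_{Sub}(\mathbf{x},\mathbf{x}_1,\{\mathbf{x}_{w2}\})\rightarrow\neg\exists(\mathbf{x}_2,\{\mathbf{x}_w\})\,d_{PE}(\mathbf{x}_1,\mathbf{x}_2,\{\mathbf{x}_w\})\bigr),$$ a formula of PA with the single free variable $\mathbf{x}$, and let $G_1$ be the sentence $g_1(\overline{\#g_1(\mathbf{x})})$, i.e. $$G_1\;:\;\forall(\mathbf{x}_1,\{\mathbf{x}_{w2}\})\bigl(d_{Sub}(\overline{\#g_1(\mathbf{x})},\mathbf{x}_1,\{\mathbf{x}_{w2}\})\rightarrow\neg\exists(\mathbf{x}_2,\{\mathbf{x}_w\})\,d_{PE}(\mathbf{x}_1,\mathbf{x}_2,\{\mathbf{x}_w\})\bigr).$$ If PA is consistent, then $G_1$ is not provable in PA; if PA is $\omega$-consistent, then $\neg G_1$ is not provable in PA.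
   Context: PA is first-order Peano Arithmetic in the language with $0$, successor $'$, $+$, $\times$, $=$. A standard effective Gödel coding of formulas and proofs of PA by natural numbers is fixed; $\#F$ denotes the Gödel code of $F$. $\mathbb{N}=\{0,1,2,\dots\}$; solutions of Diophantine equations are always sought in $\mathbb{N}$. For $n\in\mathbb{N}$, $\overline{n}$ is the numeral $0''\cdots{}'$ ($n$ successors). $\{x_w\}$, $\{x_{w2}\}$ abbreviate finite tuples of variables (different tuples consist of different variables), and $\forall(\dots)$, $\exists(\dots)$ blocks of quantifiers; boldface variables are formal variables of PA. Representational formula: given a polynomial $D$ with integer coefficients, rewrite $D=0$ as $D_L=D_R$, where $D_L,D_R$ are polynomials with natural-number coefficients; replace each variable or parameter by a formal variable of PA, each power by a repeated product, and each natural-number constant by its numeral. The resulting formula $d_L=d_R$ of PA is the representational formula of $D=0$. By the MRDP theorem one fixes the following polynomials with integer coefficients. $D_{PE}(y,x_0,\{x_w\})$: for every formula $F$ of PA and every $a\in\mathbb{N}$, $a$ is the Gödel code of a proof of $F$ in PA iff $D_{PE}(\#F,a,\{x_w\})=0$ has a solution $\{x_w\}$ in $\mathbb{N}$. $D_{Sub}(a,b,\{x_{w2}\})$: for all $a,b\in\mathbb{N}$, the equation $D_{Sub}(a,b,\{x_{w2}\})=0$ has a solution $\{x_{w2}\}$ in $\mathbb{N}$ iff $a=\#A(\mathbf{x})$ for a formula $A(\mathbf{x})$ with just one free variable $\mathbf{x}$ and $b=\#A(\overline{a})$. $d_{PE}$ and $d_{Sub}$ are their representational formulas. PA is $\omega$-consistent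 if there is no formula $A(\mathbf{x})$ with one free variable such that $\mathrm{PA}\vdash A(\overline{n})$ for every $n\in\mathbb{N}$ and $\mathrm{PA}\vdash\neg\forall\mathbf{x}\,A(\mathbf{x})$. *)

(* Defs.v *)
From HB Require Import structures.
From mathcomp Require Import all_boot all_order all_algebra.
From mathcomp Require Import mpoly.

Set Implicit Arguments.
Unset Strict Implicit.
Unset Printing Implicit Defensive.

Import GRing.Theory.

(* Formal variables are named by natural numbers. *)
Definition var := nat.

Inductive term : Type :=
| tVar of var
| tZero
| tSucc of term
| tAdd of term & term
| tMul of term & term.

Inductive formula : Type :=
| fEq of term & term
| fNeg of formula
| fImp of formula & formula
| fAll of var & formula.

Definition fEx (x : var) (A : formula) : formula := fNeg (fAll x (fNeg A)).

Definition fAlls (xs : seq var) (A : formula) : formula := foldr fAll A xs.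
Definition fExs (xs : seq var) (A : formula) : formula := foldr fEx A xs.

Definition numeral (n : nat) : term := iter n tSucc tZero.

Fixpoint term_vars (t : term) : seq var :=
  match t with
  | tVar y => [:: y]
  | tZero => [::]
  | tSucc t => term_vars t
  | tAdd t u | tMul t u => term_vars t ++ term_vars u
  end.

Fixpoint free_vars (A : formula) : seq var :=
  match A with
  | fEq t u => term_vars t ++ term_vars u
  | fNeg A => free_vars A
  | fImp A B => free_vars A ++ free_vars B
  | fAll y A => [seq z <- free_vars A | z != y]
  end.

Definition one_free_var (A : formula) (x : var) : Prop :=
  free_vars A =i [:: x].

Fixpoint subst_term (x : var) (s : term) (t : term) : term :=
  match t with
  | tVar y => if y == x then s else tVar y
  | tZero => tZero
  | tSucc t => tSucc (subst_term x s t)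
  | tAdd t u => tAdd (subst_term x s t) (subst_term x s u)
  | tMul t u => tMul (subst_term x s t) (subst_term x s u)
  end.

(* Replaces the free occurrences of x by s, without renaming bound variables:
   this is the intended A(s) when s is free for x in A, in particular when s is
   closed. *)
Fixpoint subst (x : var) (s : term) (A : formula) : formula :=
  match A with
  | fEq t u => fEq (subst_term x s t) (subst_term x s u)
  | fNeg A => fNeg (subst x s A)
  | fImp A B => fImp (subst x s A) (subst x s B)
  | fAll y A => if y == x then fAll y A else fAll y (subst x s A)
  end.

Fixpoint free_for (s : term) (x : var) (A : formula) : bool :=
  match A with
  | fEq _ _ => true
  | fNeg A => free_for s x A
  | fImp A B => free_for s x A && free_for s x B
  | fAll y B =>
      (x \notin free_vars (fAll y B)) || (y \notin term_vars s) && free_for s x B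
  end.

(* Mendelson's Hilbert-style axiomatization.  The number-theoretic axioms are
   schemas over terms, and reflexivity of equality and its congruence for + and
   * are derivable.  In [ax_ind] the term x' is always free for x in A. *)
Inductive axiom : formula -> Prop :=
| ax_K A B : axiom (fImp A (fImp B A))
| ax_S A B C :
    axiom (fImp (fImp A (fImp B C)) (fImp (fImp A B) (fImp A C)))
| ax_contra A B :
    axiom (fImp (fImp (fNeg B) (fNeg A)) (fImp (fImp (fNeg B) A) B))
| ax_inst x A s : free_for s x A -> axiom (fImp (fAll x A) (subst x s A))
| ax_dist x A B :
    x \notin free_vars A ->
    axiom (fImp (fAll x (fImp A B)) (fImp A (fAll x B)))
| ax_eq_trans t u v : axiom (fImp (fEq t u) (fImp (fEq t v) (fEq u v)))
| ax_eq_succ t u : axiom (fImp (fEq t u) (fEq (tSucc t) (tSucc u)))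
| ax_succ_neq0 t : axiom (fNeg (fEq tZero (tSucc t)))
| ax_succ_inj t u : axiom (fImp (fEq (tSucc t) (tSucc u)) (fEq t u))
| ax_add0 t : axiom (fEq (tAdd t tZero) t)
| ax_addS t u : axiom (fEq (tAdd t (tSucc u)) (tSucc (tAdd t u)))
| ax_mul0 t : axiom (fEq (tMul t tZero) tZero)
| ax_mulS t u : axiom (fEq (tMul t (tSucc u)) (tAdd (tMul t u) t))
| ax_ind x A :
    axiom (fImp (subst x tZero A)
             (fImp (fAll x (fImp A (subst x (tSucc (tVar x)) A))) (fAll x A))).

(* Every line is an axiom, or follows from earlier lines by modus ponens or
   generalization; the default value of [nth] is never reached. *)
Definition is_proof (p : seq formula) : Prop :=
  let line := nth (fEq tZero tZero) p in
  forall i, i < size p ->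
  [\/ axiom (line i),
      exists j k, [/\ j < i, k < i & line k = fImp (line j) (line i)]
    | exists j x, j < i /\ line i = fAll x (line j)].

Definition proof_of (p : seq formula) (F : formula) : Prop :=
  is_proof p /\ exists q, p = rcons q F.

Definition provable (F : formula) : Prop := exists p, proof_of p F.

Definition PA_consistent : Prop :=
  ~ exists F, provable F /\ provable (fNeg F).

Definition PA_omega_consistent : Prop :=
  ~ exists A x, [/\ one_free_var A x,
                    forall n, provable (subst x (numeral n) A)
                  & provable (fNeg (fAll x A))].

(* [CodeSeq.code] is the computable bijection from finite sequences of natural
   numbers to natural numbers of the library; the head of each sequence below is
   the tag of a constructor. *)
Fixpoint code_term (t : term) : nat :=
  match t with
  | tVar x => CodeSeq.code [:: 0; x]
  | tZero => CodeSeq.code [:: 1]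
  | tSucc t => CodeSeq.code [:: 2; code_term t]
  | tAdd t u => CodeSeq.code [:: 3; code_term t; code_term u]
  | tMul t u => CodeSeq.code [:: 4; code_term t; code_term u]
  end.

Fixpoint code_formula (A : formula) : nat :=
  match A with
  | fEq t u => CodeSeq.code [:: 5; code_term t; code_term u]
  | fNeg A => CodeSeq.code [:: 6; code_formula A]
  | fImp A B => CodeSeq.code [:: 7; code_formula A; code_formula B]
  | fAll x A => CodeSeq.code [:: 8; x; code_formula A]
  end.

Definition code_proof (p : seq formula) : nat :=
  CodeSeq.code (map code_formula p).

Definition eval_nat (n : nat) (D : {mpoly int[n]}) (a : n.-tuple nat) : int :=
  (D.@[fun i => Posz (tnth a i)])%R.

(* c * x_0 * ... * x_0 * ... * x_(n-1) * ... * x_(n-1), where c is the absolute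
   value of the coefficient of the monomial m in D and each x_i, repeated m i
   times, is replaced by the i-th term of ts. *)
Definition monomial_term (n : nat) (D : {mpoly int[n]}) (ts : n.-tuple term)
    (m : 'X_{1..n}) : term :=
  foldl tMul (numeral (absz (D@_m)%R))
    (flatten [seq nseq (m i) (tnth ts i) | i <- enum 'I_n]).

Definition sum_term (s : seq term) : term :=
  if s is t :: s' then foldl tAdd t s' else tZero.

(* D = 0 is rewritten as D_L = D_R by moving the monomials with a negative
   coefficient to the right-hand side.  With ts a tuple of formal variables this
   is the representational formula d_L = d_R of D = 0; the variables may also be
   instantiated directly by terms. *)
Definition rep_formula (n : nat) (D : {mpoly int[n]}) (ts : n.-tuple term) :
    formula :=
  fEq
    (sum_term [seq monomial_term D ts m | m <- msupp D & (0 < D@_m)%R])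
    (sum_term [seq monomial_term D ts m | m <- msupp D & (D@_m < 0)%R]).

Definition represents_proof (k : nat) (D : {mpoly int[k.+2]}) : Prop :=
  forall (F : formula) (a : nat),
    (exists p, proof_of p F /\ a = code_proof p) <->
    (exists w : k.-tuple nat,
        eval_nat D [tuple of [:: code_formula F, a & w]] = 0%R).

Definition represents_subst (l : nat) (D : {mpoly int[l.+2]}) : Prop :=
  forall a b : nat,
    (exists w : l.-tuple nat, eval_nat D [tuple of [:: a, b & w]] = 0%R) <->
    (exists A x, [/\ one_free_var A x, a = code_formula A
                   & b = code_formula (subst x (numeral a) A)]).

Section GoedelSentence.
Variables (k l : nat) (DPE : {mpoly int[k.+2]}) (DSub : {mpoly int[l.+2]}).
Variables (x x1 x2 : var) (xw : k.-tuple var) (xw2 : l.-tuple var).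

Definition g1 : formula :=
  fAlls (x1 :: xw2)
    (fImp (rep_formula DSub [tuple of [:: tVar x, tVar x1 & map tVar xw2]])
          (fNeg (fExs (x2 :: xw)
             (rep_formula DPE [tuple of [:: tVar x1, tVar x2 & map tVar xw]])))).

Definition G1 : formula := subst x (numeral (code_formula g1)) g1.

End GoedelSentence.

Lemma subst_term_foldl x s op :
  (forall t u, subst_term x s (op t u) =
               op (subst_term x s t) (subst_term x s u)) ->
  forall ts t, subst_term x s (foldl op t ts) =
               foldl op (subst_term x s t) (map (subst_term x s) ts).
Proof. by move=> opE; elim=> [//|u ts IHts] t /=; rewrite IHts opE. Qed.

Lemma subst_rep_formula x s (n : nat) (D : {mpoly int[n]}) (ts : n.-tuple term) :
  subst x s (rep_formula D ts) = rep_formula D (map_tuple (subst_term x s) ts).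
Proof.
have numE c : subst_term x s (numeral c) = numeral c by elim: c => //= c ->.
have sumE us : subst_term x s (sum_term us) = sum_term (map (subst_term x s) us).
  by case: us => //= u us; rewrite subst_term_foldl.
rewrite /rep_formula /= !sumE -!map_comp.
have monE : subst_term x s \o monomial_term D ts
            =1 monomial_term D (map_tuple (subst_term x s) ts).
  move=> m /=; rewrite /monomial_term subst_term_foldl // numE map_flatten.
  rewrite -map_comp; congr (foldl _ _ (flatten _)).
  by apply: eq_map => i /=; rewrite map_nseq tnth_map.
by rewrite !(eq_map monE).
Qed.

(* With s the numeral of the code of g1, this is the explicit form of G1. *)
Lemma subst_g1 (k l : nat) (DPE : {mpoly int[k.+2]}) (DSub : {mpoly int[l.+2]})
    (x x1 x2 : var) (xw : k.-tuple var) (xw2 : l.-tuple var) (s : term) :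
  uniq ([:: x, x1, x2 & xw] ++ xw2) ->
  subst x s (g1 DPE DSub x x1 x2 xw xw2) =
  fAlls (x1 :: xw2)
    (fImp (rep_formula DSub [tuple of [:: s, tVar x1 & map tVar xw2]])
          (fNeg (fExs (x2 :: xw)
             (rep_formula DPE [tuple of [:: tVar x1, tVar x2 & map tVar xw]])))).
Proof.
case/andP; rewrite !inE !mem_cat !negb_or => /and4P[xx1 xx2 xxw xxw2] _.
have allsE ys A : x \notin ys -> subst x s (fAlls ys A) = fAlls ys (subst x s A).
  by elim: ys => //= y ys IH; rewrite inE negb_or eq_sym => /andP[/negPf-> /IH->].
have exsE ys A : x \notin ys -> subst x s (fExs ys A) = fExs ys (subst x s A).
  by elim: ys => //= y ys IH; rewrite inE negb_or eq_sym => /andP[/negPf-> /IH->].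
have varsE ys : x \notin ys -> map (subst_term x s) (map tVar ys) = map tVar ys.
  elim: ys => //= y ys IH; rewrite inE negb_or => /andP[xy /IH->].
  by rewrite eq_sym (negPf xy).
have impE A B : subst x s (fImp A (fNeg B)) =
                 fImp (subst x s A) (fNeg (subst x s B)).
  by [].
rewrite /g1 allsE ?inE ?negb_or ?xx1 // impE exsE ?inE ?negb_or ?xx2 //.
rewrite !subst_rep_formula.
have -> : map_tuple (subst_term x s) [tuple of [:: tVar x, tVar x1 & map tVar xw2]]
          = [tuple of [:: s, tVar x1 & map tVar xw2]].
  by apply: val_inj; rewrite /= eqxx varsE // eq_sym (negPf xx1).
have -> // : map_tuple (subst_term x s) [tuple of [:: tVar x1, tVar x2 & map tVar xw]]
             = [tuple of [:: tVar x1, tVar x2 & map tVar xw]].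
by apply: val_inj; rewrite /= varsE // ![_ == x]eq_sym (negPf xx1) (negPf xx2).
Qed.

(* Main.v *)
Require Import Defs.
From mathcomp Require Import all_boot all_order all_algebra.
From mathcomp Require Import mpoly.

(* A closed instance of a representational formula is a closed equation, which PA
   decides according to the value of the polynomial.  So, with g the code of g1,
   the matrix dSub(g, x1, ..) -> ~ dPE(x1, x2, ..) of G1 is refuted at some numerals
   when G1 is provable (x1 the code of G1, x2 that of a proof), and otherwise it is
   provable at all numerals, because a solution of DSub(g, b, ..) = 0 forces b to
   be the code of G1 (coding is injective and g1 has x as its only free variable).
   The latter excludes ~ G1 once omega-consistency is extended from one quantifier
   to a block. *)

Set Implicit Arguments.
Unset Strict Implicit.
Unset Printing Implicit Defensive.

Import Order.TTheory GRing.Theory Num.Theory.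

(** * Extending and concatenating formal proofs *)

Lemma is_proof_rcons p A :
  is_proof p ->
  [\/ axiom A,
      exists B C, [/\ (exists2 j, j < size p & nth (fEq tZero tZero) p j = B),
                      (exists2 j, j < size p & nth (fEq tZero tZero) p j = C)
                    & C = fImp B A]
    | exists B y, (exists2 j, j < size p & nth (fEq tZero tZero) p j = B) /\
                  A = fAll y B] ->
  is_proof (rcons p A).
Proof.
move=> prp justA line i; rewrite {}/line size_rcons ltnS leq_eqVlt => /orP[/eqP-> | ltip].
  rewrite (nth_rcons _ p A (size p)) ltnn eqxx.
  case: justA => [axA | [B [C [[j ltj jB] [k ltk kC] defC]]] | [B [y [[j ltj jB] defA]]]].
  - by constructor 1.
  - constructor 2; exists j, k; split=> //.
    by rewrite !nth_rcons ltj ltk jB kC defC.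
  - by constructor 3; exists j, y; split=> //; rewrite nth_rcons ltj jB defA.
case: (prp i ltip) => [axi | [j [k [ltj ltk defk]]] | [j [y [ltj defi]]]].
- by constructor 1; rewrite nth_rcons ltip.
- constructor 2; exists j, k; split=> //.
  by rewrite !nth_rcons ltip (ltn_trans ltj ltip) (ltn_trans ltk ltip).
- constructor 3; exists j, y; split=> //.
  by rewrite !nth_rcons ltip (ltn_trans ltj ltip).
Qed.

Lemma is_proof_cat p q : is_proof p -> is_proof q -> is_proof (p ++ q).
Proof.
move=> prp prq line i; rewrite {}/line size_cat => lti.
have [ltip | leip] := ltnP i (size p).
  case: (prp i ltip) => [axi | [j [k [ltj ltk defk]]] | [j [y [ltj defi]]]].
  - by constructor 1; rewrite nth_cat ltip.
  - constructor 2; exists j, k; split=> //.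
    by rewrite !nth_cat ltip (ltn_trans ltj ltip) (ltn_trans ltk ltip).
  - constructor 3; exists j, y; split=> //.
    by rewrite !nth_cat ltip (ltn_trans ltj ltip).
have shift j : nth (fEq tZero tZero) (p ++ q) (size p + j) =
               nth (fEq tZero tZero) q j.
  by rewrite nth_cat ltnNge leq_addr addKn.
have ltiq : i - size p < size q by rewrite ltn_subLR.
rewrite -(subnKC leip).
case: (prq _ ltiq) => [axi | [j [k [ltj ltk defk]]] | [j [y [ltj defi]]]].
- by constructor 1; rewrite shift.
- by constructor 2; exists (size p + j), (size p + k); rewrite !ltn_add2l !shift.
- by constructor 3; exists (size p + j), y; rewrite ltn_add2l !shift.
Qed.

Lemma provable_axiom A : axiom A -> provable A.
Proof.
move=> axA; exists [:: A]; split; last by exists [::].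
by move=> i; case: i => // _; constructor 1.
Qed.

(** Locates the conclusion of a proof once further lines follow it; [r] may be empty, which covers
    the proof that comes last. *)
Lemma nth_mid (q r : seq formula) A :
  exists2 j, j < size (rcons q A ++ r) & nth (fEq tZero tZero) (rcons q A ++ r) j = A.
Proof.
exists (size q); first by rewrite size_cat size_rcons addSn ltnS leq_addr.
by rewrite nth_cat size_rcons ltnSn nth_rcons ltnn eqxx.
Qed.

Lemma provable_mp A B : provable (fImp A B) -> provable A -> provable B.
Proof.
move=> [p [prp [p' defp]]] [q [prq [q' defq]]].
exists (rcons (p ++ q) B); split; last by exists (p ++ q).
apply: is_proof_rcons (is_proof_cat prp prq) _; constructor 2.
exists A, (fImp A B); split=> //; last by rewrite defp; apply: nth_mid.
by rewrite -[p ++ q]cats0 defq -rcons_cat; apply: nth_mid.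
Qed.

Lemma provable_gen y A : provable A -> provable (fAll y A).
Proof.
move=> [p [prp [p' defp]]]; exists (rcons p (fAll y A)).
split; last by exists p.
apply: is_proof_rcons => //; constructor 3; exists A, y; split=> //.
by rewrite -[p]cats0 defp; apply: nth_mid.
Qed.

(** * Derivations from hypotheses *)

(** Hypotheses are kept as nested implications, so that the deduction theorem is mere unfolding:
    [entails [::] A] and [entails [:: A] B] are convertible to [provable A] and
    [provable (fImp A B)]. *)
Definition entails (G : seq formula) (A : formula) := provable (foldr fImp A G).

Lemma provable_K A B : provable A -> provable (fImp B A).
Proof. exact/provable_mp/provable_axiom/ax_K. Qed.

Lemma provable_S A B C :
  provable (fImp A (fImp B C)) -> provable (fImp A B) -> provable (fImp A C).
Proof. by move=> pABC; apply/provable_mp/(provable_mp _ pABC)/provable_axiom/ax_S. Qed.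

Lemma provable_trans A B C :
  provable (fImp A B) -> provable (fImp B C) -> provable (fImp A C).
Proof. by move=> pAB pBC; apply: provable_S pAB; apply: provable_K. Qed.

Lemma provable_refl A : provable (fImp A A).
Proof.
apply: (@provable_S _ (fImp A A)); first exact/provable_axiom/ax_K.
exact/provable_axiom/ax_K.
Qed.

Lemma entailsW G A : provable A -> entails G A.
Proof. by move=> pA; elim: G => //= C G IH; apply: provable_K. Qed.

Lemma entails_axiom G A : axiom A -> entails G A.
Proof. by move=> axA; apply/entailsW/provable_axiom. Qed.

Lemma entailsS G C A : entails G A -> entails (C :: G) A.
Proof. exact: provable_K. Qed.

Lemma entails_mp G A B : entails G (fImp A B) -> entails G A -> entails G B.
Proof.
(* Modus ponens under [G] is made a single theorem of PA, by induction on [G] from [ax_S]. *)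
suff dist : provable (fImp (foldr fImp (fImp A B) G)
                        (fImp (foldr fImp A G) (foldr fImp B G))).
  by move=> /(provable_mp dist)/provable_mp.
elim: G => [|C G IH] /=; first exact: provable_refl.
apply: (@provable_trans _ (fImp C (fImp (foldr fImp A G) (foldr fImp B G)))).
  apply: provable_mp (provable_K C IH); exact/provable_axiom/ax_S.
exact/provable_axiom/ax_S.
Qed.

Lemma entails0 G A : entails (A :: G) A.
Proof.
rewrite /entails /=; elim: G => [|C G IH] /=; first exact: provable_refl.
by apply: provable_trans IH _; apply/provable_axiom/ax_K.
Qed.

Lemma entails_rcons G A B : entails (rcons G A) B = entails G (fImp A B).
Proof. by rewrite /entails foldr_rcons. Qed.

(** Generalization acts on the whole nested implication; [ax_dist] then moves the quantifier inwards
    past each hypothesis, which must therefore not contain [y] free. *)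
Lemma entails_gen G y A :
  all (fun C => y \notin free_vars C) G -> entails G A -> entails G (fAll y A).
Proof.
move=> freshG pA; apply: (provable_mp _ (provable_gen y pA)).
elim: G freshG {pA} => [_|C G IH /= /andP[yC /IH pG]]; first exact: provable_refl.
apply: (@provable_trans _ (fImp C (fAll y (foldr fImp A G)))).
  exact/provable_axiom/ax_dist.
apply: provable_mp (provable_K C pG); exact/provable_axiom/ax_S.
Qed.

Lemma entails_inst G y A s :
  free_for s y A -> entails G (fAll y A) -> entails G (subst y s A).
Proof. by move=> ffA; apply: entails_mp; apply/entails_axiom/ax_inst. Qed.

Lemma entails_exfalso G A B : entails G A -> entails G (fNeg A) -> entails G B.
Proof.
move=> pA pNA; apply: entails_mp (_ : entails G (fImp (fNeg B) A)).
  apply: (entails_mp (entails_axiom G (ax_contra A B))).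
  exact: entails_mp (entails_axiom G (ax_K _ _)) pNA.
exact: entails_mp (entails_axiom G (ax_K _ _)) pA.
Qed.

Lemma provable_dne A : provable (fImp (fNeg (fNeg A)) A).
Proof.
have H := entails_axiom [:: fNeg (fNeg A)] (ax_contra (fNeg A) A).
apply: (entails_mp (entails_mp H _)); last exact/entailsW/provable_refl.
exact: entails_mp (entails_axiom _ (ax_K _ _)) (entails0 _ _).
Qed.

(** To conclude [fNeg A], the axiom [ax_contra] asks for both premises under [fNeg (fNeg A)]; double
    negation elimination carries them there from [A]. *)
Lemma entails_neg G A B :
  entails (rcons G A) B -> entails (rcons G A) (fNeg B) -> entails G (fNeg A).
Proof.
rewrite !entails_rcons => pB pNB.
have lift X : entails G (fImp A X) -> entails G (fImp (fNeg (fNeg A)) X).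
  move=> pX; rewrite -entails_rcons; apply: (@entails_mp _ A).
    by rewrite entails_rcons; apply: entails_mp (entails_axiom _ (ax_K _ _)) pX.
  by rewrite entails_rcons; apply/entailsW/provable_dne.
apply: entails_mp (lift _ pB); apply: entails_mp (lift _ pNB).
exact/entails_axiom/ax_contra.
Qed.

Lemma entails_contrap G A B :
  entails G (fImp A B) -> entails G (fNeg B) -> entails G (fNeg A).
Proof.
move=> pAB pNB; apply: (@entails_neg _ _ B); rewrite entails_rcons //.
exact: entails_mp (entails_axiom _ (ax_K _ _)) pNB.
Qed.

Lemma entails_dni G A : entails G A -> entails G (fNeg (fNeg A)).
Proof.
move=> pA; apply: (@entails_neg _ _ A); rewrite entails_rcons.
  exact: entails_mp (entails_axiom _ (ax_K _ _)) pA.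
exact/entailsW/provable_refl.
Qed.

(** * Substitution and free variables *)

Lemma term_vars_numeral n : term_vars (numeral n) = [::].
Proof. by elim: n. Qed.

Lemma subst_term_fresh y s t : y \notin term_vars t -> subst_term y s t = t.
Proof.
elim: t => //= [z|t IHt|t IHt u IHu|t IHt u IHu].
- by rewrite inE eq_sym => /negPf->.
- by move/IHt->.
- by rewrite mem_cat negb_or => /andP[/IHt-> /IHu->].
- by rewrite mem_cat negb_or => /andP[/IHt-> /IHu->].
Qed.

Lemma subst_numeral y s n : subst_term y s (numeral n) = numeral n.
Proof. by rewrite subst_term_fresh // term_vars_numeral. Qed.

Lemma subst_fresh y s A : y \notin free_vars A -> subst y s A = A.
Proof.
elim: A => //= [t u|A IHA|A IHA B IHB|z A IHA].
- by rewrite mem_cat negb_or => /andP[yt yu]; rewrite !subst_term_fresh.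
- by move/IHA->.
- by rewrite mem_cat negb_or => /andP[/IHA-> /IHB->].
- have [-> // | zy] := eqVneq z y.
  by rewrite mem_filter eq_sym zy => /IHA->.
Qed.

Lemma subst_var y A : subst y (tVar y) A = A.
Proof.
have substt t : subst_term y (tVar y) t = t.
  elim: t => //= [z|t ->|t -> u ->|t -> u ->] //.
  by have [->|] := eqVneq z y.
elim: A => //= [t u|A ->|A -> B ->|z A ->] //; first by rewrite !substt.
by case: ifP.
Qed.

Lemma subst_subst y s t A :
  subst y s (subst y t A) = subst y (subst_term y s t) A.
Proof.
have substt u : subst_term y s (subst_term y t u) = subst_term y (subst_term y s t) u.
  elim: u => //= [z|u ->|u -> v ->|u -> v ->] //.
  by case E: (z == y); rewrite //= E.
elim: A => //= [u v|A ->|A -> B ->|z A IHA] //; first by rewrite !substt.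
by case: (eqVneq z y) => [->|/negPf zy] /=; rewrite ?eqxx // zy IHA.
Qed.

Lemma free_for_closed s y A : term_vars s = [::] -> free_for s y A.
Proof.
by move=> cl; elim: A => //= [A -> B ->|z A ->] //; rewrite cl orbT.
Qed.

Lemma free_for_var y A : free_for (tVar y) y A.
Proof.
elim: A => //= [A -> B -> // | z A ->]; rewrite mem_filter (eq_sym y z) inE.
by case: (z == y); rewrite ?orbT.
Qed.

Lemma provable_inst y A s : free_for s y A -> provable A -> provable (subst y s A).
Proof. by move=> ff /(provable_gen y); apply: (@entails_inst [::]). Qed.

(** Case distinction between zero and successor inside PA: the induction axiom, with the successor
    case weakened to an induction step. *)
Lemma provable_cases y A :
  provable (subst y tZero A) -> provable (subst y (tSucc (tVar y)) A) -> provable A.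
Proof.
move=> p0 pS.
have := provable_mp (provable_mp (provable_axiom (ax_ind y A)) p0)
  (provable_gen y (provable_K A pS)).
by move/(@entails_inst [::] _ _ _ (free_for_var y A)); rewrite subst_var.
Qed.

(** * Equality and arithmetic on numerals in PA *)

Lemma provable_eq_refl t : provable (fEq t t).
Proof.
have p0 := provable_axiom (ax_add0 t).
exact: provable_mp (provable_mp (provable_axiom (ax_eq_trans _ t t)) p0) p0.
Qed.

Lemma entails_eq_sym G t u : entails G (fEq t u) -> entails G (fEq u t).
Proof.
move=> ptu; apply: entails_mp (entailsW G (provable_eq_refl t)).
exact: entails_mp (entails_axiom G (ax_eq_trans _ _ _)) ptu.
Qed.

Lemma entails_eq_trans G t u v :
  entails G (fEq t u) -> entails G (fEq u v) -> entails G (fEq t v).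
Proof.
move=> /entails_eq_sym put puv; apply: entails_mp puv.
exact: entails_mp (entails_axiom G (ax_eq_trans _ _ _)) put.
Qed.

Lemma entails_eq_succ G t u :
  entails G (fEq t u) -> entails G (fEq (tSucc t) (tSucc u)).
Proof. exact/entails_mp/entails_axiom/ax_eq_succ. Qed.

Lemma entails_succ_inj G t u :
  entails G (fEq (tSucc t) (tSucc u)) -> entails G (fEq t u).
Proof. exact/entails_mp/entails_axiom/ax_succ_inj. Qed.

Lemma entails_zero_succ G t A : entails G (fEq tZero (tSucc t)) -> entails G A.
Proof. by move/entails_exfalso; apply; apply/entails_axiom/ax_succ_neq0. Qed.

Lemma entails_hyp1 G A B : entails [:: A] B -> entails (A :: G) B.
Proof. by move=> pB; apply: entails_mp (entails0 G A); apply: entailsS; apply: entailsW. Qed.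

Lemma fresh_var t : exists y, y \notin term_vars t.
Proof.
exists (foldr maxn 0 (term_vars t)).+1; apply/negP => yt.
suff /(_ _ yt) : {in term_vars t, forall z, z <= foldr maxn 0 (term_vars t)}.
  by rewrite ltnn.
elim: (term_vars t) => //= z s IH v; rewrite inE leq_max => /orP[/eqP->|/IH->].
  by rewrite leqnn.
by rewrite orbT.
Qed.

(** Shared by addition and multiplication. Congruence of [op] is not an axiom, so [u] is first
    generalized to a variable [y]; an outer induction on [m], with a case distinction on [y] inside
    PA, then reduces everything to the recursion equations. *)
Lemma entails_numeral_op (op : term -> term -> term) (opn : nat -> nat -> nat) :
  (forall y s t u, subst_term y s (op t u) = op (subst_term y s t) (subst_term y s u)) ->
  (forall G t n, entails G (fEq t (numeral n)) ->
     entails G (fEq (op t tZero) (numeral (opn n 0)))) ->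
  (forall G t n u m, entails G (fEq t (numeral n)) ->
     entails G (fEq (op t u) (numeral (opn n m))) ->
     entails G (fEq (op t (tSucc u)) (numeral (opn n m.+1)))) ->
  forall G t n u m, entails G (fEq t (numeral n)) -> entails G (fEq u (numeral m)) ->
  entails G (fEq (op t u) (numeral (opn n m))).
Proof.
move=> substop op0 opS G t n u m pt pu.
suff {G pt pu} H : provable (fImp (fEq t (numeral n))
    (fImp (fEq u (numeral m)) (fEq (op t u) (numeral (opn n m))))).
  exact: entails_mp (entails_mp (entailsW G H) pt) pu.
(* Since [y] does not occur in [t], putting [u] back for [y] changes only the second argument. *)
have [y yt] := fresh_var t.
suff H : provable (fImp (fEq t (numeral n))
    (fImp (fEq (tVar y) (numeral m)) (fEq (op t (tVar y)) (numeral (opn n m))))).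
  have := @provable_inst y _ u _ H.
  by rewrite /= substop !subst_numeral subst_term_fresh //= eqxx; apply.
(* Of the four cases, the two in which [y] and [m] have different shapes are absurd by
   [ax_succ_neq0]. *)
elim: m => [|m IHm]; apply: (@provable_cases y);
  rewrite /= ?substop !subst_numeral subst_term_fresh //= eqxx;
  rewrite -[provable _]/(entails [:: _; _] _).
- exact/op0/entails_hyp1/entails0.
- by apply: entailsS; apply: entails_zero_succ (entails_eq_sym (entails0 _ _)).
- by apply: entailsS; apply: entails_zero_succ (entails0 _ _).
- have pt : entails [:: fEq t (numeral n); fEq (tSucc (tVar y)) (numeral m.+1)]
              (fEq t (numeral n)) by apply: entails0.
  apply: (opS _ _ _ _ _ pt).
  apply: (entails_mp (entails_mp (entailsW _ IHm) pt)).
  exact/entailsS/entails_succ_inj/entails0.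
Qed.

Lemma entails_addn G t n u m :
  entails G (fEq t (numeral n)) -> entails G (fEq u (numeral m)) ->
  entails G (fEq (tAdd t u) (numeral (n + m))).
Proof.
apply: entails_numeral_op => // {G t n u m} [G t n | G t n u m _] ptn.
  by rewrite addn0; apply: entails_eq_trans ptn; apply/entails_axiom/ax_add0.
rewrite addnS; apply: entails_eq_trans (entails_eq_succ ptn).
exact/entails_axiom/ax_addS.
Qed.

Lemma entails_muln G t n u m :
  entails G (fEq t (numeral n)) -> entails G (fEq u (numeral m)) ->
  entails G (fEq (tMul t u) (numeral (n * m))).
Proof.
apply: entails_numeral_op => // {G t n u m} [G t n | G t n u m] ptn.
  by rewrite muln0 => *; apply/entails_axiom/ax_mul0.
move=> ptu; rewrite mulnS addnC; apply: entails_eq_trans (entails_addn ptu ptn).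
exact/entails_axiom/ax_mulS.
Qed.

(** * Closed equations are decided by PA *)

(** The value in the standard model; 0 for a variable is a filler, as the value is meaningful for
    closed terms only. *)
Fixpoint term_val (t : term) : nat :=
  match t with
  | tVar _ | tZero => 0
  | tSucc t => (term_val t).+1
  | tAdd t u => term_val t + term_val u
  | tMul t u => term_val t * term_val u
  end.

Lemma term_val_numeral n : term_val (numeral n) = n.
Proof. by elim: n => //= n ->. Qed.

Lemma provable_term_val t :
  term_vars t = [::] -> provable (fEq t (numeral (term_val t))).
Proof.
elim: t => //= [_|t IHt|t IHt u IHu|t IHt u IHu].
- exact: provable_eq_refl.
- by move/IHt/(@entails_eq_succ [::]).
- by case: (term_vars t) IHt => //= IHt ut; apply: (@entails_addn [::]); [exact: IHt | exact: IHu].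
- by case: (term_vars t) IHt => //= IHt ut; apply: (@entails_muln [::]); [exact: IHt | exact: IHu].
Qed.

Lemma provable_numeral_neq n m :
  n != m -> provable (fNeg (fEq (numeral n) (numeral m))).
Proof.
have step G (P : formula) a b : (forall H, entails H (fEq a b) -> entails H P) ->
    entails G (fNeg P) -> entails G (fNeg (fEq a b)).
  move=> PH; apply: entails_contrap; rewrite -entails_rcons.
  by apply: PH; rewrite entails_rcons; apply/entailsW/provable_refl.
elim: n m => [|n IHn] [|m] //= nm.
- exact/provable_axiom/ax_succ_neq0.
- apply: (@step [::]); last exact/provable_axiom/(ax_succ_neq0 (numeral n)).
  by move=> H; apply: entails_eq_sym.
- by apply: (@step [::]) (IHn m nm) => H; apply: entails_succ_inj.
Qed.

Lemma provable_closed_eq t u :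
    term_vars t = [::] -> term_vars u = [::] ->
  if term_val t == term_val u then provable (fEq t u) else provable (fNeg (fEq t u)).
Proof.
move=> /provable_term_val pt /provable_term_val pu; case: eqP => [tu | /eqP tu].
  apply: (@entails_eq_trans [::]) pt _; rewrite tu; exact: (@entails_eq_sym [::]).
apply: (@entails_contrap [::]) (provable_numeral_neq tu).
apply: entails_eq_trans (entailsW [:: fEq t u] pu).
apply: entails_eq_trans (entails0 _ _); exact/entails_eq_sym/entailsW.
Qed.

(** * Variables and values of representational formulas *)

Lemma term_vars_foldl op t us :
  (forall t u, term_vars (op t u) = term_vars t ++ term_vars u) ->
  term_vars (foldl op t us) = term_vars t ++ flatten (map term_vars us).
Proof.
move=> opE; elim: us t => [|u us IH] t /=; first by rewrite cats0.
by rewrite IH opE catA.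
Qed.

Lemma term_vars_sum us : term_vars (sum_term us) = flatten (map term_vars us).
Proof. by case: us => //= u us; rewrite term_vars_foldl. Qed.

(** A monomial of the support has a nonzero coefficient, hence lands on one of the two sides, where
    the [i]-th term is written [m i] times, so not at all for exponent 0. *)
Lemma mem_free_vars_rep n (D : {mpoly int[n]}) (ts : n.-tuple term) v :
  reflect (exists (m : 'X_{1..n}) i, [/\ m \in msupp D, m i != 0 & v \in term_vars (tnth ts i)])
          (v \in free_vars (rep_formula D ts)).
Proof.
have monE (m : 'X_{1..n}) : reflect (exists2 i, m i != 0 & v \in term_vars (tnth ts i))
                      (v \in term_vars (monomial_term D ts m)).
  rewrite term_vars_foldl // term_vars_numeral map_flatten -map_comp.
  apply: (iffP flattenP) => [[ws /flatten_mapP[i _ /=]] | [i mi vi]].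
    by rewrite map_nseq mem_nseq lt0n => /andP[mi /eqP->] vi; exists i.
  exists (term_vars (tnth ts i)) => //; apply/flatten_mapP.
  by exists i; rewrite ?mem_enum //= map_nseq mem_nseq lt0n mi eqxx.
rewrite /= !term_vars_sum -!map_comp mem_cat.
apply: (iffP orP) => [|[m [i [mD mi vi]]]].
  by case=> /flatten_mapP[m]; rewrite mem_filter => /andP[_ mD]
     /monE[i mi vi]; exists m, i.
have vm : v \in term_vars (monomial_term D ts m) by apply/monE; exists i.
have : (D@_m != 0)%R by rewrite -mcoeff_msupp.
rewrite neq_lt => /orP[neg | pos]; [right | left];
  by apply/flatten_mapP; exists m; rewrite // mem_filter mD andbT.
Qed.

Lemma term_val_foldl_mul t us :
  term_val (foldl tMul t us) = term_val t * \prod_(u <- us) term_val u.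
Proof.
elim: us t => [|u us IH] t /=; first by rewrite big_nil muln1.
by rewrite IH big_cons mulnA.
Qed.

Lemma term_val_sum us : term_val (sum_term us) = \sum_(u <- us) term_val u.
Proof.
case: us => [|u us] /=; first by rewrite big_nil.
rewrite big_cons; elim: us u => [|w us IH] u /=; first by rewrite big_nil addn0.
by rewrite IH big_cons addnA.
Qed.

Lemma term_val_monomial n (D : {mpoly int[n]}) (a : n.-tuple nat) (m : 'X_{1..n}) :
  term_val (monomial_term D (map_tuple numeral a) m) =
  (absz (D@_m)%R * \prod_(i < n) tnth a i ^ m i)%N.
Proof.
rewrite term_val_foldl_mul term_val_numeral; congr (_ * _).
rewrite big_flatten big_map big_enum /=; apply: eq_bigr => i _.
by rewrite big_nseq tnth_map term_val_numeral iter_muln_1.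
Qed.

(** The value of [D] at [a] is the value of the left side minus that of the right side, so it
    vanishes exactly when the closed equation is true. *)
Lemma provable_rep_formula n (D : {mpoly int[n]}) (a : n.-tuple nat) :
  let A := rep_formula D (map_tuple numeral a) in
  if eval_nat D a == 0%R then provable A else provable (fNeg A).
Proof.
move=> A.
have : free_vars A = [::].
  case E: (free_vars A) => [//|v s]; have : v \in free_vars A by rewrite E mem_head.
  by case/mem_free_vars_rep => m [i []]; rewrite tnth_map term_vars_numeral.
rewrite /A /=; set L := sum_term _; set R := sum_term _ => /eqP.
rewrite -size_eq0 size_cat addn_eq0 !size_eq0 => /andP[/eqP cL /eqP cR].
suff -> : (eval_nat D a == 0%R) = (term_val L == term_val R).
  exact: provable_closed_eq.
have -> : eval_nat D a = (Posz (term_val L) - Posz (term_val R))%R.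
  rewrite !term_val_sum !big_map !big_filter /eval_nat mevalE.
  have PoszE (P : pred 'X_{1..n}) :
    Posz (\sum_(m <- msupp D | P m) term_val (monomial_term D (map_tuple numeral a) m))
    = (\sum_(m <- msupp D | P m) `|D@_m| * \prod_(i < n) Posz (tnth a i) ^+ m i)%R.
    rewrite (big_morph Posz PoszD (erefl _)); apply: eq_bigr => m _.
    rewrite term_val_monomial PoszM abszE (big_morph Posz PoszM (erefl _)).
    by congr (_ * _)%R; apply: eq_bigr => i _; rewrite -rmorphXn.
  rewrite !PoszE [LHS](bigID (fun m => 0 < D@_m)%R) /= -sumrN.
  congr (_ + _)%R; first by apply: eq_bigr => m /gtr0_norm->.
  (* Membership in the support is kept as a condition: it excludes the coefficient 0, so that not
     positive means negative. *)
  rewrite big_seq_cond [RHS]big_seq_cond; apply: eq_big => m.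
    rewrite mcoeff_msupp -leNgt le_eqVlt.
    by case: eqP => //= ->; rewrite ltxx.
  rewrite mcoeff_msupp -leNgt => /andP[_ /ler0_norm->].
  by rewrite mulNr opprK.
by rewrite subr_eq0.
Qed.

(** * Injectivity of the coding *)

Lemma code_term_inj : injective code_term.
Proof.
have codeI := can_inj CodeSeq.codeK.
elim=> [y||t IHt|t IHt u IHu|t IHt u IHu] [z||t'|t' u'|t' u'] /codeI //.
- by case=> ->.
- by case=> /IHt->.
- by case=> /IHt-> /IHu->.
- by case=> /IHt-> /IHu->.
Qed.

Lemma code_formula_inj : injective code_formula.
Proof.
have codeI := can_inj CodeSeq.codeK.
elim=> [t u|A IHA|A IHA B IHB|y A IHA] [t' u'|A'|A' B'|y' A'] /codeI //.
- by case=> /code_term_inj-> /code_term_inj->.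
- by case=> /IHA->.
- by case=> /IHA-> /IHB->.
- by case=> -> /IHA->.
Qed.

(** 0 is the code of the empty sequence, whereas a formula is coded by a nonempty one. *)
Lemma code_formula_neq0 A : code_formula A <> 0.
Proof. by case: A => [t u|A|A B|y A] /(can_inj CodeSeq.codeK (x2 := [::])). Qed.

(** * Blocks of quantifiers *)

Lemma free_for_fresh s y A : y \notin free_vars A -> free_for s y A.
Proof.
elim: A => //= [A IHA B IHB|z A _ ->] //.
by rewrite mem_cat negb_or => /andP[/IHA-> /IHB->].
Qed.

Lemma mem_free_vars_fAlls ys A v :
  (v \in free_vars (fAlls ys A)) = (v \notin ys) && (v \in free_vars A).
Proof.
by elim: ys => //= y ys IH; rewrite mem_filter IH inE negb_or andbA.
Qed.

Lemma mem_free_vars_fExs ys A v :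
  (v \in free_vars (fExs ys A)) = (v \notin ys) && (v \in free_vars A).
Proof.
by elim: ys => //= y ys IH; rewrite mem_filter IH inE negb_or andbA.
Qed.

Lemma provable_fAlls ys A : provable A -> provable (fAlls ys A).
Proof. by move=> pA; elim: ys => //= y ys; apply: provable_gen. Qed.

Lemma fAlls_elim ys A : provable (fImp (fAlls ys A) A).
Proof.
elim: ys => [|y ys IH] /=; first exact: provable_refl.
have := @entails_inst [:: fAll y (fAlls ys A)] y _ _ (free_for_var y _) (entails0 _ _).
by rewrite subst_var => /provable_trans; apply.
Qed.

Lemma entails_fAlls G ys A :
  all (fun C => ~~ has (mem ys) (free_vars C)) G -> entails G A -> entails G (fAlls ys A).
Proof.
move=> freshG pA; elim: ys freshG => //= y ys IH freshG.
apply: entails_gen; [|apply: IH]; apply: sub_all freshG => C; apply: contra.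
  by move=> yC; apply/hasP; exists y; rewrite //= mem_head.
by case/hasP=> z zC zys; apply/hasP; exists z; rewrite //= inE [z \in ys]zys orbT.
Qed.

(** As [fEx] abbreviates [fNeg (fAll _ (fNeg _))], the negated block is a universal block with a
    double negation in front of each quantifier. *)
Lemma entails_neg_fExs G ys A :
  all (fun C => ~~ has (mem ys) (free_vars C)) G ->
  entails G (fNeg A) -> entails G (fNeg (fExs ys A)).
Proof.
move=> freshG pA; elim: ys freshG => //= y ys IH freshG; apply: entails_dni.
apply: entails_gen; [|apply: IH]; apply: sub_all freshG => C; apply: contra.
  by move=> yC; apply/hasP; exists y; rewrite //= mem_head.
by case/hasP=> z zC zys; apply/hasP; exists z; rewrite //= inE [z \in ys]zys orbT.
Qed.

Lemma neg_fExs_elim ys A : provable (fImp (fNeg (fExs ys A)) (fNeg A)).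
Proof.
elim: ys => [|y ys IH] /=; first exact: provable_refl.
apply: (provable_trans _ IH); apply: (provable_trans (provable_dne _)).
exact: (fAlls_elim [:: y]).
Qed.

Lemma fAlls_imp ys A B : provable (fImp A B) -> provable (fImp (fAlls ys A) (fAlls ys B)).
Proof.
move=> pAB; apply: (@entails_fAlls [:: fAlls ys A]).
  rewrite /= andbT; apply/hasP => -[v].
  by rewrite mem_free_vars_fAlls => /andP[/negP vys _] /vys.
exact: provable_trans (fAlls_elim ys A) pAB.
Qed.

(** * Numeral instances under a valuation *)

Definition ground_term (f : var -> nat) (ys : seq var) (t : term) : term :=
  foldl (fun t y => subst_term y (numeral (f y)) t) t ys.

(** Numerals are closed, so substituting them one variable at a time amounts to a simultaneous
    substitution. *)
Definition ground (f : var -> nat) (ys : seq var) (A : formula) : formula :=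
  foldl (fun A y => subst y (numeral (f y)) A) A ys.

Lemma eq_in_ground f g ys A : {in ys, f =1 g} -> ground f ys A = ground g ys A.
Proof.
elim: ys A => //= y ys IH A fg; rewrite fg ?mem_head //.
by apply: IH => z zys; apply: fg; rewrite inE zys orbT.
Qed.

Lemma provable_ground f ys A : provable A -> provable (ground f ys A).
Proof.
elim: ys A => //= y ys IH A pA; apply/IH/provable_inst => //.
exact/free_for_closed/term_vars_numeral.
Qed.

Lemma ground_numeral f ys n : ground_term f ys (numeral n) = numeral n.
Proof. by elim: ys => //= y ys; rewrite subst_numeral. Qed.

Lemma ground_var f ys y : y \in ys -> ground_term f ys (tVar y) = numeral (f y).
Proof.
elim: ys => //= z ys IH; rewrite inE.
by case: eqVneq => [-> _|_ /IH] //; rewrite ground_numeral.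
Qed.

Lemma ground_imp_neg f ys A B :
  ground f ys (fImp A (fNeg B)) = fImp (ground f ys A) (fNeg (ground f ys B)).
Proof. by elim: ys A B => //= y ys IH A B; apply: IH. Qed.

Lemma ground_rep_formula f ys n (D : {mpoly int[n]}) (ts : n.-tuple term) :
  ground f ys (rep_formula D ts) = rep_formula D (map_tuple (ground_term f ys) ts).
Proof.
elim: ys ts => [|y ys IH] ts.
  by rewrite -[LHS]/(rep_formula D ts); congr rep_formula; apply: eq_from_tnth => i; rewrite tnth_map.
rewrite -[LHS]/(ground f ys (subst y (numeral (f y)) (rep_formula D ts))).
rewrite subst_rep_formula IH; congr rep_formula.
by apply: eq_from_tnth => i; rewrite !tnth_map.
Qed.

(** * Omega-consistency for a block of quantifiers *)

(** If [t + y] equals the numeral of [n], then [y] is one of the finitely many numerals up to [n].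
    PA sees this by [n + 1] successive case distinctions on [y]. *)
Lemma provable_sum_step n y t B :
  y \notin term_vars t ->
  (forall i m, i + m = n -> provable (fImp (fEq t (numeral m)) (subst y (numeral i) B))) ->
  provable (fImp (fEq (tAdd t (tVar y)) (numeral n)) B).
Proof.
move=> yt; elim: n B => [|n IHn] B pB; apply: (@provable_cases y);
  rewrite /= ?subst_numeral subst_term_fresh //= eqxx.
- apply: provable_trans (pB 0 0 _) => //; rewrite -[provable _]/(entails [:: _] _).
  apply: entails_eq_trans (entails0 _ _); apply: entails_eq_sym.
  exact/entails_axiom/ax_add0.
- rewrite -[provable _]/(entails [:: _] _).
  apply: (@entails_zero_succ _ (tAdd t (tVar y))); apply: entails_eq_sym.
  apply: entails_eq_trans (entails0 _ _); apply: entails_eq_sym.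
  exact/entails_axiom/ax_addS.
- apply: provable_trans (pB 0 n.+1 _) => //; rewrite -[provable _]/(entails [:: _] _).
  apply: entails_eq_trans (entails0 _ _); apply: entails_eq_sym.
  exact/entails_axiom/ax_add0.
(* [B] was generalized for this case: in the formula with the successor of [y] for [y], the instance
   at [i] is the instance of [B] at [i.+1]. *)
- apply: provable_trans (IHn (subst y (tSucc (tVar y)) B) _); last first.
    move=> i m imn; rewrite subst_subst /= eqxx; apply: (pB i.+1).
  by rewrite addSn imn.
  rewrite -[provable _]/(entails [:: _] _); apply: entails_succ_inj.
  apply: entails_eq_trans (entails0 _ _); apply: entails_eq_sym.
  exact/entails_axiom/ax_addS.
Qed.

Definition sum_vars (ys : seq var) : term := foldr (fun y t => tAdd t (tVar y)) tZero ys.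

Lemma mem_sum_vars ys : term_vars (sum_vars ys) =i ys.
Proof. by elim: ys => //= y ys IH v; rewrite mem_cat IH !inE orbC. Qed.

Lemma provable_sum_vars ys n B :
  uniq ys -> (forall f, provable (ground f ys B)) ->
  provable (fImp (fEq (sum_vars ys) (numeral n)) B).
Proof.
elim: ys n B => [|y ys IH] n B /=; first by move=> _ /(_ id); apply: provable_K.
move=> /andP[yys uys] pB; apply: provable_sum_step => [|i m _].
  by rewrite mem_sum_vars.
(* The valuation is changed at [y] to the value [i] just found; the other variables keep theirs
   because [y] is not among them. *)
apply: IH => // f; have := pB (fun z => if z == y then i else f z).
rewrite /= eqxx -(@eq_in_ground f) // => z zys.
by case: eqP yys => // <-; rewrite zys.
Qed.

(* omega-consistency only speaks about one quantifier, and "every numeral instance is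
   provable" does not pass through a block of quantifiers one variable at a time.
   The block is therefore bounded by a single variable z standing for the sum of
   the block: for z a numeral only finitely many instances of B matter. *)
Lemma omega_consistent_block z ys B :
  PA_omega_consistent -> uniq (z :: ys) -> {subset free_vars B <= ys} ->
  (forall f, provable (ground f ys B)) -> ~ provable (fNeg (fAlls ys B)).
Proof.
move=> omega /= /andP[zys uys] freeB pB pN; apply: omega.
have zB : z \notin free_vars B by apply: contra zys; apply: freeB.
have zS : z \notin term_vars (sum_vars ys) by rewrite mem_sum_vars.
have subst_fAlls s A : subst z s (fAlls ys A) = fAlls ys (subst z s A).
  elim: ys zys {uys freeB pB pN zS} => //= y ys IH.
  by rewrite inE negb_or eq_sym => /andP[/negPf-> /IH->].
(* [C] says that [B] holds for all tuples of sum [z]; it is the formula to which omega-consistency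
   is applied. *)
pose C := fAlls ys (fImp (fEq (sum_vars ys) (tVar z)) B).
have freeC : one_free_var C z.
  move=> v; rewrite mem_free_vars_fAlls /= !mem_cat mem_sum_vars !inE.
  case: (boolP (v \in ys)) => [vys | nvys] /=.
    by apply/esym/negbTE; apply: contraNneq zys => <-.
  by case: (boolP (v \in free_vars B)) => [/freeB|]; rewrite ?(negPf nvys) ?orbF.
exists C, z; split=> // [n|].
  rewrite subst_fAlls /= eqxx subst_term_fresh // subst_fresh //.
  exact/provable_fAlls/provable_sum_vars.
apply: (@entails_contrap [::]) pN; apply: (@entails_fAlls [:: fAll z C]).
  rewrite /= andbT; apply/hasP => -[v]; rewrite mem_filter freeC inE.
  by case: eqP.
have freshC : z \notin free_vars (fAll z C) by rewrite mem_filter eqxx.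
(* The block [ys] is stripped under the quantifier on [z], so that [z] can become [sum_vars ys]
   without capture; the premise then reads as an identity and leaves [B]. *)
have : entails [:: fAll z C] (fAll z (fImp (fEq (sum_vars ys) (tVar z)) B)).
  apply: entails_gen; first by rewrite /= freshC.
  apply: entails_mp (entailsW _ (fAlls_elim ys _)) _.
  exact: entails_mp (entailsW _ (fAlls_elim [:: z] C)) (entails0 _ _).
move/(@entails_inst _ _ _ (sum_vars ys)) => /=.
rewrite eqxx subst_term_fresh // subst_fresh // => /(_ (free_for_fresh _ zB)).
by move/entails_mp; apply; apply/entailsW/provable_eq_refl.
Qed.

(** * Free variables of the formulas at hand *)

Lemma free_vars_rep_formula n (D : {mpoly int[n]}) (ts : n.-tuple term) :
  {subset free_vars (rep_formula D ts) <= flatten (map term_vars ts)}.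
Proof.
move=> v /mem_free_vars_rep[m [i [_ _ vi]]]; apply/flattenP.
by exists (term_vars (tnth ts i)); rewrite // -tnth_map mem_tnth.
Qed.

Lemma flatten_term_vars_tVar (ys : seq var) : flatten (map term_vars (map tVar ys)) = ys.
Proof. by elim: ys => //= y ys ->. Qed.

Lemma mem_free_vars_imp_neg A B v :
  (v \in free_vars (fImp A (fNeg B))) = (v \in free_vars A) || (v \in free_vars B).
Proof. exact: mem_cat. Qed.

(** Otherwise the value of [DSub] would not depend on its first argument, and a solution for some
    [a] would also be one for 0, which codes no formula. This makes [x] really occur in [g1]. *)
Lemma represents_subst_mnm0 l (DSub : {mpoly int[l.+2]}) :
  represents_subst DSub -> exists2 m, m \in msupp DSub & m ord0 != 0.
Proof.
move=> hSub; apply/hasP; apply/negPn/negP => /hasPn noX0.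
have [a [b [w Dw0]]] : exists a b (w : l.-tuple nat), eval_nat DSub [tuple of [:: a, b & w]] = 0%R.
  pose A := fEq (tVar 0) (tVar 0).
  exists (code_formula A), (code_formula (subst 0 (numeral (code_formula A)) A)).
  by apply/hSub; exists A, 0; split=> // v; rewrite !inE orbb.
have [] := (hSub 0 b).1; last by move=> B [y [_ /esym/code_formula_neq0]].
exists w; rewrite -Dw0 /eval_nat !mevalE; apply: eq_big_seq => m /noX0.
rewrite negbK => /eqP m0; congr (_ * _)%R; apply: eq_bigr => i _.
(* The two tuples agree beyond position 0, and at position 0 the exponent is 0. *)
by case: (unliftP ord0 i) => [j|] ->; [rewrite !(tnth_nth 0) | rewrite m0].
Qed.

(** * The Gödel sentence and its independence *)

Section Incompleteness.

Variables (k l : nat) (DPE : {mpoly int[k.+2]}) (DSub : {mpoly int[l.+2]}).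
Hypotheses (hPE : represents_proof DPE) (hSub : represents_subst DSub).
Variables (x x1 x2 : var) (xw : k.-tuple var) (xw2 : l.-tuple var).
Hypothesis hvars : uniq ([:: x, x1, x2 & xw] ++ xw2).

Let g := g1 DPE DSub x x1 x2 xw xw2.
Let G := G1 DPE DSub x x1 x2 xw xw2.
Let P := rep_formula DSub
  [tuple of [:: numeral (code_formula g), tVar x1 & map tVar xw2]].
Let Q := rep_formula DPE [tuple of [:: tVar x1, tVar x2 & map tVar xw]].
Let ys1 : seq var := x1 :: xw2.
Let ys2 : seq var := x2 :: xw.
Let ys := ys1 ++ ys2.

Let G1E : G = fAlls ys1 (fImp P (fNeg (fExs ys2 Q))).
Proof. by rewrite /G /G1 subst_g1. Qed.

Let uniq_ys : uniq (x :: ys).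
Proof.
rewrite -(perm_uniq (s1 := [:: x, x1, x2 & xw] ++ xw2)) //=.
by rewrite perm_cons /= /ys /ys1 /ys2 perm_cons -cat_cons perm_catC.
Qed.

(** Needed for [represents_subst] to apply to [g1] itself. The occurrence of [x] comes from a
    monomial of [DSub] with a nonzero exponent at position 0. *)
Lemma one_free_var_g1 : one_free_var g x.
Proof.
have nxys : x \notin ys by case/andP: uniq_ys.
have neg_ys1 : x \notin ys1 by apply: contra nxys; rewrite mem_cat => ->.
move=> v; rewrite mem_free_vars_fAlls.
rewrite mem_free_vars_imp_neg mem_free_vars_fExs mem_seq1; apply/idP/eqP => [|->].
  case/andP=> /negP v1 /orP[|/andP[/negP v2]] /free_vars_rep_formula;
    rewrite /= flatten_term_vars_tVar.
    by rewrite inE => /orP[/eqP|/v1].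
  by rewrite inE => /orP[/eqP vx1 | /v2 //]; case: v1; rewrite vx1 mem_head.
rewrite neg_ys1 /=; apply/orP; left; apply/mem_free_vars_rep.
have [m mD m0] := represents_subst_mnm0 hSub.
by exists m, ord0; split=> //; rewrite (tnth_nth (tVar 0)) mem_head.
Qed.

Lemma code_subst_g1 b :
  (exists w : l.-tuple nat,
     eval_nat DSub [tuple of [:: code_formula g, b & w]] = 0%R) <->
  b = code_formula G.
Proof.
rewrite hSub; split=> [[A [y [freeA /code_formula_inj gA ->]]] | ->].
  have : y \in free_vars g by rewrite gA freeA mem_head.
  by rewrite -gA one_free_var_g1 mem_seq1 => /eqP->.
by exists g, x; split=> //; apply: one_free_var_g1.
Qed.

(** Both sides of the implication become closed instances, which [provable_rep_formula] decides. *)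
Let ground_matrix f : ground f ys (fImp P (fNeg Q)) =
  fImp (rep_formula DSub (map_tuple numeral [tuple of [:: code_formula g, f x1 & map f xw2]]))
    (fNeg (rep_formula DPE (map_tuple numeral [tuple of [:: f x1, f x2 & map f xw]]))).
Proof.
have mapE (zs : seq var) : {subset zs <= ys} ->
    map (ground_term f ys) (map tVar zs) = map numeral (map f zs).
  move=> zsys; rewrite -!map_comp; apply/eq_in_map => z /zsys.
  exact: ground_var.
have ys1ys : {subset ys1 <= ys} by move=> z z1; rewrite mem_cat z1.
have ys2ys : {subset ys2 <= ys} by move=> z z2; rewrite mem_cat z2 orbT.
rewrite ground_imp_neg !ground_rep_formula; congr fImp; last congr fNeg;
  congr rep_formula; apply: val_inj.
  rewrite -[LHS]/(ground_term f ys (numeral _) :: map (ground_term f ys) (map tVar ys1)).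
  by rewrite ground_numeral mapE.
rewrite -[LHS]/(ground_term f ys (tVar x1) :: map (ground_term f ys) (map tVar ys2)).
by rewrite mapE // ground_var // ys1ys ?mem_head.
Qed.

Let matrix_of_G : provable G -> provable (fImp P (fNeg Q)).
Proof.
rewrite G1E => /(provable_mp (fAlls_elim _ _))/provable_trans; apply.
exact: neg_fExs_elim.
Qed.

(** The quantifiers on [ys2] can be moved inside because [P] contains none of these variables. This
    prenex form has the single universal block that [omega_consistent_block] requires. *)
Let G_of_matrix : provable (fImp (fAlls ys (fImp P (fNeg Q))) G).
Proof.
have -> A : fAlls ys A = fAlls ys1 (fAlls ys2 A) by apply: foldr_cat.
rewrite G1E; apply: fAlls_imp.
apply: (@entails_neg_fExs [:: fAlls ys2 (fImp P (fNeg Q)); P]); last first.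
  exact: fAlls_elim.
apply/and3P; split=> //; apply/hasPn => v.
  by rewrite mem_free_vars_fAlls => /andP[].
move=> /free_vars_rep_formula /=.
rewrite term_vars_numeral flatten_term_vars_tVar => v1.
have : uniq (ys1 ++ ys2) by case/andP: uniq_ys.
rewrite cat_uniq => /and3P[_ /hasPn disj _].
by apply: contraL v1; apply: disj.
Qed.

Lemma consistent_G1 : PA_consistent -> ~ provable G.
Proof.
move=> consistent pG; have [p prfG] := pG.
have /hPE[w Dw] : exists p', proof_of p' G /\ code_proof p = code_proof p' by exists p.
have [w2 Dw2] := (code_subst_g1 (code_formula G)).2 erefl.
(* The solutions of both equations, listed in the order of [ys]; [f] reads each variable's value off
   this list. *)
pose vs : seq nat := (code_formula G :: w2) ++ code_proof p :: w.
pose f y := nth 0 vs (index y ys).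
have sz : size ys = size vs by rewrite !size_cat /= !size_tuple.
have : map f ys = vs.
  apply: (@eq_from_nth _ 0); rewrite size_map // => i lti.
  rewrite (nth_map 0) // /f index_uniq //; by case/andP: uniq_ys.
move/eqP; rewrite map_cat eqseq_cat; last by rewrite /= size_map !size_tuple.
case/andP=> /eqP[f1 fw2] /eqP[f2 fw].
have /esym Ea : [tuple of [:: code_formula g, f x1 & map f xw2]] =
    [tuple of [:: code_formula g, code_formula G & w2]].
  by apply: val_inj; rewrite /= f1 fw2.
have /esym Eb : [tuple of [:: f x1, f x2 & map f xw]] =
    [tuple of [:: code_formula G, code_proof p & w]].
  by apply: val_inj; rewrite /= f1 f2 fw.
rewrite {}Ea in Dw2; rewrite {}Eb in Dw.
have := provable_rep_formula DSub [tuple of [:: code_formula g, f x1 & map f xw2]].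
have := provable_rep_formula DPE [tuple of [:: f x1, f x2 & map f xw]].
rewrite Dw Dw2 eqxx => pQ pP.
have := provable_ground f ys (matrix_of_G pG); rewrite ground_matrix.
move=> /provable_mp/(_ pP) pNQ; apply: consistent; eexists; split; [exact: pQ | exact: pNQ].
Qed.

Lemma omega_consistent_neg_G1 : PA_omega_consistent -> ~ provable (fNeg G).
Proof.
move=> omega pN.
(* From a contradiction PA would prove everything, in particular the negation of the generalization
   of [v = v], all of whose instances are provable. *)
have consistent : PA_consistent.
  move=> [A [pA pNA]]; apply: omega; exists (fEq (tVar 0) (tVar 0)), 0; split.
  - by move=> v; rewrite !inE orbb.
  - by move=> n; apply: provable_eq_refl.
  - exact: (@entails_exfalso [::] A).
(* A numeral has replaced [x] in [P], so [x] can serve as the variable bounding the block. *)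
apply: (@omega_consistent_block x ys (fImp P (fNeg Q)) omega uniq_ys).
- move=> v; rewrite mem_cat => /orP[] /free_vars_rep_formula /=.
    by rewrite term_vars_numeral flatten_term_vars_tVar => v1; rewrite mem_cat; apply/orP; left.
  rewrite flatten_term_vars_tVar inE mem_cat => /orP[/eqP->|->]; last by rewrite orbT.
  by rewrite mem_head.
- move=> f; rewrite ground_matrix.
  set a := [tuple of [:: code_formula g, _ & _]]; set b := [tuple of [:: f x1, _ & _]].
  have := provable_rep_formula DSub a; case: eqP => [Da0 _ | _ pNP]; last first.
    by apply: (@entails_exfalso [:: _] _ _ (entails0 _ _)); apply: entailsW.
  (* Were the [DPE] equation true as well, [f x2] would code a proof of [G], against the first
     half. *)
  apply: provable_K; have := provable_rep_formula DPE b; case: eqP => // Db0 _.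
  have f1 : f x1 = code_formula G by apply/code_subst_g1; exists (map_tuple f xw2).
  case: (consistent_G1 consistent).
  have [|p [prfG _]] := (hPE G (f x2)).2; last by exists p.
  by exists (map_tuple f xw); rewrite -Db0 /b; congr eval_nat; apply: val_inj; rewrite /= f1.
- exact: (@entails_contrap [::]) G_of_matrix pN.
Qed.

End Incompleteness.

Theorem theorem2 (k l : nat) (DPE : {mpoly int[k.+2]}) (DSub : {mpoly int[l.+2]})
    (hPE : represents_proof DPE) (hSub : represents_subst DSub)
    (x x1 x2 : var) (xw : k.-tuple var) (xw2 : l.-tuple var)
    (hvars : uniq ([:: x, x1, x2 & xw] ++ xw2)) :
  (PA_consistent -> ~ provable (G1 DPE DSub x x1 x2 xw xw2)) /\
  (PA_omega_consistent -> ~ provable (fNeg (G1 DPE DSub x x1 x2 xw xw2))).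
Proof. by split; [apply: consistent_G1 | apply: omega_consistent_neg_G1]. Qed.
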